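(* Let $X$ be a vector field on $\mathbb{P}^2_{\mathbb{C}}$ and let $d$ be a positive integer. Then the equation of every algebraic curve of degree less than or equal to $d$ that is invariant by $X$ is a factor of $\mathcal{E}_d(X)$. Moreover, if $\mathcal{E}_d(X)=0$, then $X$ has a meromorphic first integral of degree at most $d$.
   Context: A vector field $X$ on $\mathbb{P}^2_{\mathbb{C}}$ is represented by a vector field $X=A\frac{\partial}{\partial x}+B\frac{\partial}{\partial y}+C\frac{\partial}{\partial z}$ on $\mathbb{C}^3$ whose coefficients are homogeneous polynomials of the same degree, inducing via the radial projection a field of directions on $\mathbb{P}^2_{\mathbb{C}}$ (so $X$ is not a multiple of the radial field $R=x\frac{\partial}{\partial x}+y\frac{\partial}{\partial y}+z\frac{\partial}{\partial z}$); two homogeneous vector fields whose difference is a multiple of $R$ represent the same vector field on $\mathbb{P}^2_{\mathbb{C}}$. Extactic curves: for $n\ge 0$ let $v_1,\dots,v_N$, $N=\binom{n+2}{2}$, be a basis (e.g. the monomials) of the space of homogeneous polynomials of degree $n$ in $x,y,z$. Then $\mathcal{E}_n(X)=\det\big(X^{i}(v_j)\big)_{0\le i\le N-1,\ 1\le j\le N}$, where $X$ acts as a derivation, $X^0(f)=f$ and $X^k(f)=X(X^{k-1}(f))$. It is a homogeneous polynomial, well defined up to a nonzero constant. An algebraic curve with equation $F=0$, $F$ a nonzero homogeneous polynomial, is invariant by $X$ if $X(F)=L_F F$ for some polynomial $L_F$. A meromorphic (equivalently rational) first integral of degree $e$ is a non-constant rational function $P/Q$, with $P,Q$ coprime homogeneous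 polynomials in $x,y,z$ of degree $e$, such that $X(P/Q)=0$. *)

(* Defs.v *)
From HB Require Import structures.
From mathcomp Require Import all_boot all_order all_algebra.
From mathcomp Require Import fraction generic_quotient ring.
From mathcomp Require Export reals complex mpoly.

Set Implicit Arguments.
Unset Strict Implicit.
Unset Printing Implicit Defensive.

Import GRing.Theory.
Local Open Scope quotient_scope.
Local Open Scope ring_scope.

Local Notation frac_of := (@FracField.tofrac _).

Section Defs.

Variable K : fieldType.

Notation poly3 := {mpoly K[3]}.
Notation ratfun := {fraction {mpoly K[3]}}.

(* The variables x, y, z are 'X_0, 'X_1, 'X_2; a polynomial vector field
   A d/dx + B d/dy + C d/dz on K^3 is given by its coefficients (A, B, C). *)
Definition vfield := 'I_3 -> poly3.

Definition act (X : vfield) (f : poly3) : poly3 :=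
  \sum_(i < 3) X i * f^`M(i).

Definition multiple_of_radial (X : vfield) :=
  exists g : poly3, forall i : 'I_3, X i = g * 'X_i.

(* X represents a vector field on the projective plane.  Two representatives
   of the same field differ by a multiple of the radial field; no particular
   representative is singled out. *)
Definition represents_P2_vfield (X : vfield) :=
  (exists m : nat, forall i : 'I_3, X i \is m.-homog)
  /\ ~ multiple_of_radial X.

Definition divides (F G : poly3) := exists H : poly3, G = H * F.

(* The units of K[x, y, z] are the nonzero constants. *)
Definition coprime_poly (P Q : poly3) :=
  forall D : poly3, divides D P -> divides D Q -> D \is a GRing.unit.

Definition invariant_curve (X : vfield) (F : poly3) :=
  exists L : poly3, act X F = L * F.

Definition extactic (X : vfield) (n : nat)
    (v : 'C(n + 2, 2).-tuple (dhomog 3 K n)) : poly3 :=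
  \det (\matrix_(i < 'C(n + 2, 2), j < 'C(n + 2, 2))
          iter i (act X) (mpoly_of_dhomog (tnth v j))).

(* The extension of the derivation X to K(x, y, z), computed by the quotient
   rule on a representative fraction; by frac_actE the result does not depend
   on the representative. *)
Definition frac_act (X : vfield) (f : ratfun) : ratfun :=
  let n := \n_(repr f) in
  let q := \d_(repr f) in
  frac_of (act X n * q - n * act X q) / frac_of (q ^+ 2).

Definition first_integral (X : vfield) (e : nat) (f : ratfun) :=
  [/\ exists P Q : poly3,
        [/\ P \is e.-homog, Q \is e.-homog, Q != 0, coprime_poly P Q
          & f = frac_of P / frac_of Q],
      forall c : K, f <> frac_of c%:MP
    & frac_act X f = 0].

Lemma actM (X : vfield) (f g : poly3) :
  act X (f * g) = act X f * g + f * act X g.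
Proof.
rewrite /act mulr_suml mulr_sumr -big_split /=; apply: eq_bigr => i _.
by rewrite mderivM; ring.
Qed.

Lemma repr_fracE (f : ratfun) : f = frac_of \n_(repr f) / frac_of \d_(repr f).
Proof.
have q0 : frac_of \d_(repr f) != 0 by rewrite tofrac_eq0 denom_ratioP.
apply: (mulIf q0); rewrite divfK // -{1}[f]reprK.
set r := repr f; rewrite !piE; apply/eqmodP => /=.
rewrite /FracField.equivf /FracField.mulf !numden_Ratio ?mulf_neq0 ?oner_neq0 //.
  by rewrite !mulr1 mulrC.
all: by rewrite ?numden_Ratio ?mulr1 ?oner_neq0 // denom_ratioP.
Qed.

Lemma frac_actE (X : vfield) (P Q : poly3) : Q != 0 ->
  frac_act X (frac_of P / frac_of Q)
  = frac_of (act X P * Q - P * act X Q) / frac_of (Q ^+ 2).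
Proof.
move=> Q0; rewrite /frac_act; set f := frac_of P / frac_of Q.
have := repr_fracE f; set n := \n_(repr f); set q := \d_(repr f) => fE.
have q0 : q != 0 by exact: denom_ratioP.
have nQ : n * Q = P * q.
  apply/eqP; rewrite -tofrac_eq !tofracM -eqr_div ?tofrac_eq0 //.
  by rewrite -fE.
have dnQ : act X n * Q + n * act X Q = act X P * q + P * act X q.
  by rewrite -!actM nQ.
apply/eqP; rewrite eqr_div ?tofrac_eq0 ?expf_neq0 // -!tofracM tofrac_eq.
apply/eqP.
transitivity (q * Q * (act X n * Q + n * act X Q)
              - (q * act X Q + Q * act X q) * (n * Q)); first by ring.
by rewrite dnQ nQ; ring.
Qed.

End Defs.

(* Main.v *)
Require Import Defs.
From HB Require Import structures.
From mathcomp Require Import all_boot all_algebra fraction.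
From mathcomp Require Import boolp ring zify.

(** If [F = 0] is invariant of degree at most [d], a multiple [G] of [F] of
    degree exactly [d] is a combination of the basis [v] with constant
    coefficients, not all zero.  All the [X^i(G)] are multiples of [F], so the
    same combination of the columns of the extactic matrix is divisible by
    [F], and by Cramer's rule so is the determinant.

    For the second assertion, let [p] and [q] be two copies of the three
    homogeneous coordinates, and consider polynomials in [p] and [q], viewed as
    polynomials in [p] whose coefficients are polynomials in [q].  The field
    [X] acts on the coefficients.  A polynomial [F(p, q)] is flat along [X]
    when [F, X(F), X^2(F), ...] all vanish on the diagonal [q = p]: for fixed
    [p], the curve [F(p, .) = 0] then contains the leaf of [X] through [p].

    When the extactic determinant vanishes, a Wronskian argument
    ([wronskian_kernel]) gives polynomials [C_j], not all zero, with
    [sum_j C_j X^i(v_j) = 0] for every [i].  In other words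
    [Phi = sum_j C_j(p) v_j(q)] is flat along [X].  Flatness is a prime
    condition ([flat_along_prime]), and polynomial rings over a field are
    factorial ([factorial_mpoly]), so [Phi] has a prime factor [G] which is
    flat; by Euler's relation [G] is homogeneous in [q], of degree [k <= d].

    The key point is that every flat polynomial is a multiple of [G]
    ([flat_prime_dvd]).  Otherwise one could eliminate one of the variables [p]
    and get a nonzero flat polynomial in which only two of them occur.  But if
    [F] is flat then the differential of [F] in the variables [p] vanishes, on
    the diagonal, on [X] and on the radial field.  As these two fields are not
    proportional, both remaining partial derivatives vanish on the diagonal,
    and in fact are flat again; descending on the degree, [F = 0].

    Since [X(G)] is flat, [G] divides it.  The action of [X] on coefficients
    does not raise the degree in [p], so [X(G) = N(q) G]: the coefficients of
    [G] as a polynomial in [p] are homogeneous polynomials of degree [k] in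
    [q], all with the cofactor [N].  They are not all proportional, because
    [G] vanishes on the diagonal and a product [h(q) c(p)] does not.  The
    quotient of two nonproportional coefficients is a first integral, and
    cancelling common prime factors, which are homogeneous too, brings it to
    lowest terms. *)

Set Implicit Arguments.
Unset Strict Implicit.
Unset Printing Implicit Defensive.

Import GRing.Theory Pdiv.Idomain.
Local Open Scope ring_scope.

(** * Factorial rings *)

Section Divisibility.
Variable T : idomainType.
Implicit Types (a b c f g h p : T) (s : seq T).

Definition dvdr a b := exists c, b = c * a.

Definition prime_elt p :=
  [/\ p != 0, p \isn't a GRing.unit
    & forall a b, dvdr p (a * b) -> dvdr p a \/ dvdr p b].

Definition factorial_ring := forall a, a != 0 ->
  exists u s, [/\ u \is a GRing.unit, {in s, forall p, prime_elt p}
                & a = u * \prod_(p <- s) p].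

Lemma dvdrr a : dvdr a a.
Proof. by exists 1; rewrite mul1r. Qed.

Lemma dvdr0 a : dvdr a 0.
Proof. by exists 0; rewrite mul0r. Qed.

Lemma dvdr_mull a b c : dvdr a b -> dvdr a (c * b).
Proof. by case=> k ->; exists (c * k); rewrite mulrA. Qed.

Lemma dvdr_mulr a b c : dvdr a b -> dvdr a (b * c).
Proof. by rewrite mulrC; exact: dvdr_mull. Qed.

Lemma dvdrD a b c : dvdr a b -> dvdr a c -> dvdr a (b + c).
Proof. by move=> [k ->] [l ->]; exists (k + l); rewrite mulrDl. Qed.

Lemma dvdrB a b c : dvdr a b -> dvdr a c -> dvdr a (b - c).
Proof. by move=> [k ->] [l ->]; exists (k - l); rewrite mulrBl. Qed.

Lemma dvdr_trans b a c : dvdr a b -> dvdr b c -> dvdr a c.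
Proof. by move=> ab [k ->]; exact: dvdr_mull. Qed.

Lemma dvdr_unit a b : dvdr a b -> b \is a GRing.unit -> a \is a GRing.unit.
Proof. by case=> k ->; rewrite unitrM => /andP[]. Qed.

Lemma prime_dvd_prod p s : prime_elt p ->
  dvdr p (\prod_(q <- s) q) -> exists2 q, q \in s & dvdr p q.
Proof.
move=> [p0 pU pP]; elim: s => [|q s IH].
  by rewrite big_nil => /dvdr_unit; rewrite unitr1 => /(_ isT); rewrite (negPf pU).
rewrite big_cons => /pP[pq|/IH[r rs pr]]; first by exists q; rewrite ?mem_head.
by exists r; rewrite // inE rs orbT.
Qed.

Lemma prime_dvd_prime p w : prime_elt p -> prime_elt (w * p) ->
  w \is a GRing.unit.
Proof.
move=> [p0 pU _] [wp0 _ wpP].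
have w0 : w != 0 by apply: contraNneq wp0 => ->; rewrite mul0r.
case: (wpP w p (dvdrr _)) => -[k] E.
  case/negP: pU; apply/unitrPr; exists k.
  by apply: (mulfI w0); rewrite mulr1 {2}E; ring.
by apply/unitrPr; exists k; apply: (mulIf p0); rewrite mul1r {2}E; ring.
Qed.

(** Each prime of [s] divides [g] or [h], and is cancelled there. *)
Lemma cancel_primes s f g h : {in s, forall p, prime_elt p} ->
    (\prod_(p <- s) p) * f = g * h ->
  exists a b g' h', [/\ g = a * g', h = b * h', a * b = \prod_(p <- s) p
                      & f = g' * h'].
Proof.
elim: s g h => [|p s IH] g h sP.
  by rewrite big_nil mul1r => ->; exists 1, 1, g, h; rewrite !mul1r.
have {}IH := IH _ _ (fun q qs => sP q (@mem_behead _ (p :: s) q qs)).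
have [p0 pU pP] := sP p (mem_head _ _).
rewrite big_cons -mulrA => E.
have: dvdr p (g * h) by exists ((\prod_(j <- s) j) * f); rewrite -E mulrC.
case/pP=> -[k kE]; rewrite kE in E *.
  have /IH[a [b [g' [h' [-> -> ab ->]]]]] : (\prod_(j <- s) j) * f = k * h.
    by apply: (mulfI p0); rewrite E; ring.
  by exists (p * a), b, g', h'; split=> //; [ring | rewrite -ab mulrA].
have /IH[a [b [g' [h' [-> -> ab ->]]]]] : (\prod_(j <- s) j) * f = g * k.
  by apply: (mulfI p0); rewrite E; ring.
by exists a, (p * b), g', h'; split=> //; [ring | rewrite -ab; ring].
Qed.

(** Gauss's cancellation: in [c x = k f], the primes of [c] do not divide [f],
    so they all divide [k]. *)
Lemma cancel_coprime_primes s f x : {in s, forall p, prime_elt p} ->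
    {in s, forall p, ~ dvdr p f} -> dvdr f ((\prod_(p <- s) p) * x) ->
  dvdr f x.
Proof.
elim: s => [|p s IH] sP nf; first by rewrite big_nil mul1r.
have [p0 pU pP] := sP p (mem_head _ _).
rewrite big_cons -mulrA => -[k kE].
have: dvdr p (k * f) by exists ((\prod_(j <- s) j) * x); rewrite -kE mulrC.
case/pP=> [[l lE]|]; last by move/nf; rewrite mem_head => /(_ isT).
apply: IH => [q qs|q qs|]; [exact/sP/mem_behead | exact/nf/mem_behead |].
by exists l; apply: (mulfI p0); rewrite kE lE; ring.
Qed.

Hypothesis factT : factorial_ring.

Lemma exists_prime_factor a : a != 0 -> a \isn't a GRing.unit ->
  exists2 p, prime_elt p & dvdr p a.
Proof.
move=> a0; have [u [[|p s] [uU sP ->]]] := factT a0.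
  by rewrite big_nil mulr1 uU.
move=> _; exists p; first exact/sP/mem_head.
by rewrite big_cons; exists (u * \prod_(j <- s) j); ring.
Qed.

Lemma prime_multiplicity p f : prime_elt p -> f != 0 ->
  exists n h, f = p ^+ n * h /\ ~ dvdr p h.
Proof.
move=> pP f0; have [u [s [uU sP ->]]] := factT f0; have [p0 pU pM] := pP.
elim: s sP => [|q s IH] sP.
  exists 0, u; rewrite big_nil mulr1 expr0 mul1r; split=> //.
  by move/dvdr_unit => /(_ uU); rewrite (negPf pU).
have [|n [h [E nh]]] := IH; first by move=> r rs; apply/sP/mem_behead.
case: (pselect (dvdr p q)) => [[w wE]|nq].
  exists n.+1, (w * h); rewrite big_cons mulrCA E wE exprS; split; first by ring.
  have wU : w \is a GRing.unit.
    by apply: (prime_dvd_prime pP); rewrite -wE; apply/sP/mem_head.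
  by case/pM => //; move/dvdr_unit => /(_ wU); rewrite (negPf pU).
exists n, (q * h); rewrite big_cons mulrCA E; split; first by ring.
by case/pM.
Qed.

End Divisibility.

Arguments factorial_ring : clear implicits.

Lemma factorial_field (K : fieldType) : factorial_ring K.
Proof. by move=> a a0; exists a, [::]; rewrite big_nil mulr1 unitfE a0. Qed.

Lemma factorial_iso (R T : idomainType) (f : {rmorphism R -> T})
    (g : {rmorphism T -> R}) :
  cancel f g -> cancel g f -> factorial_ring R -> factorial_ring T.
Proof.
move=> fK gK factR a a0.
have ga0 : g a != 0 by rewrite -(rmorph0 g) (can_eq gK).
have [u [s [uU sP gaE]]] := factR _ ga0.
exists (f u), (map f s); split; first exact: rmorph_unit.
  move=> _ /mapP[p ps ->]; have [p0 pU pP] := sP p ps; split.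
  - by rewrite -(rmorph0 f) (can_eq fK).
  - by apply: contraNN pU => /(rmorph_unit g); rewrite fK.
  - move=> b c [k kE].
    have: dvdr p (g b * g c) by exists (g k); rewrite -rmorphM kE rmorphM fK.
    by case/pP=> -[l lE]; [left|right]; exists (f l); rewrite -rmorphM -lE gK.
by rewrite big_map -rmorph_prod -rmorphM -gaE gK.
Qed.

(** * Gauss's lemma *)
Section GaussLemma.
Variable R : idomainType.
Implicit Types (f g h : {poly R}).

(** Strip the leading coefficients one after the other: modulo a prime, the
    leading coefficient of a product is the product of the leading ones. *)
Lemma prime_polyC (p : R) : prime_elt p -> prime_elt p%:P.
Proof.
move=> [p0 pU pP]; split; first by rewrite polyC_eq0.
  apply: contraNN pU => /unitrP[q [qp _]]; apply/unitrP; exists q`_0.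
  by have := congr1 (fun r : {poly R} => r`_0) qp; rewrite coefMC coef1 mulrC.
move=> f g; have [n] := ubnP (size f + size g); elim: n f g => // n IH f g ltn dfg.
have [->|f0] := eqVneq f 0; first by left; exact: dvdr0.
have [->|g0] := eqVneq g 0; first by right; exact: dvdr0.
have split_lead h : h = (h - lead_coef h *: 'X^((size h).-1))
                        + lead_coef h *: 'X^((size h).-1) by rewrite subrK.
have ltB h : h != 0 -> (size (h - lead_coef h *: 'X^((size h).-1))%R
                        < size h)%N.
  move=> h0; have sh : (size h).-1.+1 = size h by rewrite prednK // size_poly_gt0.
  rewrite -[X in (_ < X)%N]sh ltnS; apply/leq_sizeP => j lej.
  rewrite coefB coefZ coefXn; case: eqVneq => [->|nej].
    by rewrite mulr1 subrr.
  rewrite mulr0 subr0 nth_default // -sh.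
  by rewrite ltn_neqAle eq_sym nej lej.
have dlead h : dvdr p (lead_coef h) ->
    dvdr p%:P (lead_coef h *: 'X^((size h).-1)).
  move=> [k ->]; exists (k *: 'X^((size h).-1)).
  by rewrite [RHS]mulrC mul_polyC scalerA mulrC.
have: dvdr p (lead_coef f * lead_coef g).
  have [k kE] := dfg; exists (lead_coef k).
  by rewrite -!lead_coefM kE lead_coefM lead_coefC.
case/pP => /dlead dl.
  case: (IH (f - lead_coef f *: 'X^((size f).-1)) g).
  - by rewrite -ltnS; apply: leq_trans ltn; rewrite ltnS ltn_add2r ltB.
  - by rewrite mulrBl; apply: dvdrB => //; apply: dvdr_mulr.
  - by move=> df; left; rewrite (split_lead f); apply: dvdrD.
  - by right.
case: (IH f (g - lead_coef g *: 'X^((size g).-1))).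
- by rewrite -ltnS; apply: leq_trans ltn; rewrite ltnS ltn_add2l ltB.
- by rewrite mulrBr; apply: dvdrB => //; apply: dvdr_mull.
- by left.
- by move=> df; right; rewrite (split_lead g); apply: dvdrD.
Qed.

Hypothesis factR : factorial_ring R.

Lemma polyC_factorization (c : R) : c != 0 ->
  exists u s, [/\ u \is a GRing.unit, {in s, forall p : R, prime_elt p}
    & c%:P = u%:P * \prod_(p <- map polyC s) p].
Proof.
move=> c0; have [u [s [uU sP ->]]] := factR c0; exists u, s; split=> //.
by rewrite rmorphM /= rmorph_prod big_map.
Qed.

(** Dividing [f] by primes of [R] shortens the factorization of its leading
    coefficient, so the process stops. *)
Lemma primitive_part f : f != 0 -> exists c f0,
  f = c%:P * f0 /\ forall p : R, prime_elt p -> ~ dvdr p%:P f0.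
Proof.
move=> f0; have lf0 : lead_coef f != 0 by rewrite lead_coef_eq0.
have [u [s [uU sP lE]]] := factR lf0.
have [e eE] : exists e, lead_coef f * e = \prod_(p <- s) p.
  by exists u^-1; rewrite lE mulrAC divrr // mul1r.
have [n] := ubnP (size s); elim: n => // n IH in s sP f f0 e eE {u uU lf0 lE} *.
move=> sn.
case: (pselect (exists2 p : R, prime_elt p & dvdr p%:P f)); last first.
  move=> np; exists 1, f; rewrite mul1r; split=> // p pP pf.
  by apply: np; exists p.
move=> [p pP [f1 f1E]]; have [p0 _ _] := pP.
have lE : lead_coef f = lead_coef f1 * p by rewrite f1E lead_coefM lead_coefC.
have: dvdr p (\prod_(q <- s) q).
  by exists (lead_coef f1 * e); rewrite -eE lE; ring.
case/(prime_dvd_prod pP) => q qs [w wE].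
have wU : w \is a GRing.unit by apply: (prime_dvd_prime pP); rewrite -wE; apply: sP.
have [c [g [gE gP]]] : exists c g, f1 = c%:P * g
    /\ forall p : R, prime_elt p -> ~ dvdr p%:P g.
  apply: (IH (rem q s) _ f1 _ (e / w)).
  - by move=> r /mem_rem; exact: sP.
  - by apply: contraNneq f0 => f10; rewrite f1E f10 mul0r.
  - have E : \prod_(r <- s) r = q * \prod_(r <- rem q s) r := big_rem q qs.
    have E' : lead_coef f1 * e = w * \prod_(r <- rem q s) r.
      by apply: (mulfI p0); rewrite mulrCA mulrA -lE eE E wE; ring.
    by rewrite mulrA E' mulrAC divrr // mul1r.
  - by rewrite size_rem //; move: sn qs; case: (s).
by exists (c * p), g; rewrite f1E gE polyCM; split=> //; ring.
Qed.

(** Over the field of fractions, Bezout's relation shows that [f] divides one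
    factor of any product it divides; this holds over [R] up to a nonzero
    constant, which cancels because [f] is primitive. *)
Lemma primitive_irreducible_prime f : (1 < size f)%N ->
    (forall p : R, prime_elt p -> ~ dvdr p%:P f) ->
    (forall c g h, c != 0 -> c *: f = g * h ->
       (size g <= 1)%N \/ (size h <= 1)%N) ->
  prime_elt f.
Proof.
move=> sf primf irrf.
have f0 : f != 0 by rewrite -size_poly_gt0 (ltn_trans _ sf).
split=> // [|g h dgh].
  by rewrite poly_unitE gtn_eqF.
have cancel_const (r : R) x : r != 0 -> dvdr f (r *: x) -> dvdr f x.
  move=> /polyC_factorization[u [s [uU sP rE]]] [k kE].
  have sP' : {in map polyC s, forall p : {poly R}, prime_elt p}.
    by move=> _ /mapP[p ps ->]; exact/prime_polyC/sP.
  apply: (cancel_coprime_primes sP').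
    by move=> _ /mapP[p ps ->]; exact/primf/sP.
  exists (u^-1%:P * k); rewrite -mulrA -kE -mul_polyC rE !mulrA.
  by rewrite -polyCM mulVr // mul1r.
case: (boolP (coprimep f g)) => [/Bezout_coprimepP[[u v] /= ]|].
  move/eqpP=> -[[c1 c2] /= /andP[c10 c20] E]; right.
  apply: (cancel_const c2) => //; rewrite -[c2 *: h]mul_polyC.
  have -> : c2%:P * h = c1%:P * (u * f + v * g) * h.
    by rewrite (mul_polyC c1) E alg_polyC.
  rewrite mulrDr mulrDl; apply: dvdrD; first by exists (c1%:P * u * h); ring.
  by case: dgh => k kE; exists (c1%:P * v * k); rewrite -!mulrA -kE; ring.
rewrite coprimep_def => ncop; left.
have /dvdpP[[c e] /= c0 E] := dvdp_gcdl f g.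
have /dvdpP[[c' e'] /= c'0 E'] := dvdp_gcdr f g.
have sgcd : (1 < size (gcdp f g))%N.
  by rewrite ltn_neqAle eq_sym ncop size_poly_gt0 gcdp_eq0 (negPf f0).
case: (irrf c e _ c0 E) => [/size1_polyC eC|]; last by rewrite leqNgt sgcd.
have e0 : e`_0 != 0.
  apply/eqP => e0; move/eqP: E; rewrite eC e0 mul0r.
  by rewrite -mul_polyC mulf_eq0 polyC_eq0 (negPf c0) (negPf f0).
apply: (cancel_const (e`_0 * c')); first by rewrite mulf_neq0.
exists (e' * c%:P); rewrite -scalerA E' -mul_polyC -eC -mulrA mul_polyC E; ring.
Qed.

(** Induction on the degree.  If [c f] splits into factors of smaller degree,
    for some nonzero constant [c], the primes of [c] cancel and [f] itself
    splits; otherwise the primitive part of [f] is prime. *)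
Lemma factorial_poly : factorial_ring {poly R}.
Proof.
move=> f; have [n] := ubnP (size f); elim: n f => // n IH f ltn f0.
have primesC s : {in s, forall p : R, prime_elt p} ->
    {in map polyC s, forall p : {poly R}, prime_elt p}.
  by move=> sP _ /mapP[p ps ->]; exact/prime_polyC/sP.
have unitC (u : R) : u \is a GRing.unit -> u%:P \is a GRing.unit.
  by move=> uU; apply: rmorph_unit.
have [sf1|sf] := leqP (size f) 1.
  have fE := size1_polyC sf1.
  have c0 : f`_0 != 0 by rewrite -polyC_eq0 -fE.
  have [u [s [uU sP E]]] := polyC_factorization c0.
  by exists u%:P, (map polyC s); rewrite fE E; split; auto.
case: (pselect (exists c g h, [/\ c != 0, c *: f = g * h,
                   (1 < size g)%N & (1 < size h)%N])).
  move=> [c [g [h [c0 E sg sh]]]].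
  have [u [s [uU sP cE]]] := polyC_factorization c0.
  have E1 : (\prod_(p <- map polyC s) p) * (u%:P * f) = g * h.
    by rewrite -E -mul_polyC cE; ring.
  have [a [b [g' [h' [gE hE abE fE]]]]] := cancel_primes (primesC _ sP) E1.
  have g0 : g != 0 by rewrite -size_poly_gt0 (ltn_trans _ sg).
  have h0 : h != 0 by rewrite -size_poly_gt0 (ltn_trans _ sh).
  have [a0 g'0] : a != 0 /\ g' != 0.
    by apply/andP; rewrite -negb_or -mulf_eq0 -gE.
  have [b0 h'0] : b != 0 /\ h' != 0.
    by apply/andP; rewrite -negb_or -mulf_eq0 -hE.
  have [sa sb] : size a = 1%N /\ size b = 1%N.
    have : size (a * b) = 1%N.
      have /(congr1 (fun p : {poly R} => size p)) := cE.
      rewrite -abE size_polyC c0 size_Cmul //.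
      by apply: contraTneq uU => ->; rewrite unitr0.
    rewrite size_mul //; move: a0 b0; rewrite -!size_poly_gt0.
    by case: (size a) (size b) => [|[|?]] [|[|?]] //; rewrite /= ?addnS.
  have sg' : size g = size g' by rewrite gE size_mul // sa add1n.
  have sh' : size h = size h' by rewrite hE size_mul // sb add1n.
  have sfE : size f = (size g' + size h').-1.
    rewrite -size_mul // -fE size_Cmul //.
    by apply: contraTneq uU => ->; rewrite unitr0.
  rewrite sg' in sg; rewrite sh' in sh.
  have [lg lh] : (size g' < n)%N /\ (size h' < n)%N.
    by move: ltn sg sh; rewrite sfE; clear; lia.
  have [u1 [s1 [u1U s1P g'E]]] := IH g' lg g'0.
  have [u2 [s2 [u2U s2P h'E]]] := IH h' lh h'0.
  exists (u^-1%:P * u1 * u2), (s1 ++ s2); split.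
  - by rewrite !unitrM u1U u2U unitC // unitrV.
  - by move=> p; rewrite mem_cat => /orP[/s1P|/s2P].
  - rewrite big_cat /=; have -> : f = u^-1%:P * (u%:P * f).
      by rewrite mulrA -polyCM mulVr // mul1r.
    by rewrite fE g'E h'E; ring.
move=> irr; have [c [f1 [fE primf1]]] := primitive_part f0.
have c0 : c != 0 by apply: contraNneq f0 => c0; rewrite fE c0 mul0r.
have [u [s [uU sP cE]]] := polyC_factorization c0.
exists u%:P, (f1 :: map polyC s); split; first exact: unitC.
  move=> p; rewrite inE => /predU1P[->|]; last exact: primesC.
  apply: primitive_irreducible_prime => // [|r g h r0 E].
    by rewrite fE size_Cmul in sf.
  have [sg|sg] := leqP (size g) 1; first by left.
  have [sh|sh] := leqP (size h) 1; first by right.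
  case: irr; exists r, (c%:P * g), h; split=> //; rewrite ?size_Cmul //.
  by rewrite fE -mulrA -E -!mul_polyC; ring.
by rewrite big_cons fE cE; ring.
Qed.

End GaussLemma.

(** * Polynomials in several variables *)

Section MpolyInduction.
Variables (n : nat) (R : comNzRingType).

(** Most identities between additive or multiplicative operations on
    polynomials are checked on constants and variables. *)
Lemma mpoly_ring_ind (P : {mpoly R[n]} -> Prop) :
    (forall c, P c%:MP) -> (forall i, P 'X_i) ->
    (forall p q, P p -> P q -> P (p + q)) ->
    (forall p q, P p -> P q -> P (p * q)) ->
  forall p, P p.
Proof.
move=> PC PX PD PM p; rewrite (mpolyE p).
apply: (big_ind P) => [||m _] //; first by rewrite -mpolyC0.
rewrite -mul_mpolyC; apply: (PM) => //; rewrite mpolyXE_id.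
apply: (big_ind P) => [||i _] //; first by rewrite -mpolyC1.
by elim: (m i) => [|k IH]; rewrite ?expr0 ?exprS -?mpolyC1 //; apply: PM.
Qed.

Lemma mpoly_hom_eq (S : nzRingType) (f g : {rmorphism {mpoly R[n]} -> S}) :
  (forall c, f c%:MP = g c%:MP) -> (forall i, f 'X_i = g 'X_i) -> f =1 g.
Proof.
move=> fgC fgX; apply: mpoly_ring_ind => // p q fp fq.
  by rewrite !rmorphD fp fq.
by rewrite !rmorphM fp fq.
Qed.
End MpolyInduction.

Section IsolateVariable.
Variables (n : nat) (R : idomainType) (k : 'I_n.+1).

(** The isomorphism of [R[x_0, ..., x_n]] with [R[x_i, i <> k][x_k]], for an
    arbitrary [k], so that any variable can be eliminated; [restore_var] below
    is its inverse. *)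
Definition isolate_var : {mpoly R[n.+1]} -> {poly {mpoly R[n]}} :=
  mmap (polyC \o @mpolyC n R)
    (fun i => if unlift k i is Some j then ('X_j)%:P else 'X).

Definition skip_var : {mpoly R[n]} -> {mpoly R[n.+1]} :=
  mmap (@mpolyC n.+1 R) (fun j => 'X_(lift k j)).

Definition restore_var : {poly {mpoly R[n]}} -> {mpoly R[n.+1]} :=
  horner_eval ('X_k) \o map_poly skip_var.

HB.instance Definition _ := GRing.RMorphism.on isolate_var.
HB.instance Definition _ := GRing.RMorphism.on skip_var.
HB.instance Definition _ := GRing.RMorphism.on restore_var.

Lemma restore_varC c : restore_var c%:P = skip_var c.
Proof. by rewrite /restore_var /= map_polyC /= /horner_eval hornerC. Qed.

Lemma restore_varX : restore_var 'X = 'X_k.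
Proof. by rewrite /restore_var /= map_polyX /horner_eval hornerX. Qed.

Lemma isolate_varK : cancel isolate_var restore_var.
Proof.
apply: (mpoly_hom_eq (f := restore_var \o isolate_var) (g := idfun)).
  by move=> c /=; rewrite [isolate_var _]mmapC restore_varC [LHS]mmapC.
move=> i /=; rewrite [isolate_var _]mmapX mmap1U.
by case: unliftP => [j|] ->; rewrite ?restore_varX // restore_varC [LHS]mmapX mmap1U.
Qed.

Lemma isolate_skip p : isolate_var (skip_var p) = p%:P.
Proof.
move: p; apply: (mpoly_hom_eq (f := isolate_var \o skip_var) (g := polyC)).
  by move=> c /=; rewrite [skip_var _]mmapC [LHS]mmapC.
move=> i /=; rewrite [skip_var _]mmapX mmap1U [LHS]mmapX mmap1U.
by rewrite liftK.
Qed.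

Lemma restore_varK : cancel restore_var isolate_var.
Proof.
apply: poly_ind => [|p c IH]; first by rewrite !rmorph0.
rewrite !rmorphD !rmorphM /= IH restore_varC isolate_skip restore_varX.
by rewrite [isolate_var _]mmapX mmap1U unlift_none.
Qed.

Lemma mderiv_skip_var p : (skip_var p)^`M(k) = 0.
Proof.
elim/mpoly_ring_ind: p => [c|i|p q pE qE|p q pE qE].
- by rewrite [skip_var _]mmapC mderivC.
- rewrite [skip_var _]mmapX mmap1U mderivX mnm1E.
  by rewrite eq_sym (negPf (neq_lift _ _)) scale0r.
- by rewrite rmorphD mderivD pE qE addr0.
- by rewrite rmorphM mderivM pE qE mul0r mulr0 addr0.
Qed.

End IsolateVariable.

Lemma factorial_mpoly (R : idomainType) n :
  factorial_ring R -> factorial_ring {mpoly R[n]}.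
Proof.
move=> factR; elim: n => [|n IH].
  apply: (factorial_iso (f := @mpolyC 0 R) (g := mcoeff 0%MM)) factR.
    exact: mpolyCK.
  exact: mpolyKC.
apply: (@factorial_iso {poly {mpoly R[n]}} {mpoly R[n.+1]}
  (restore_var ord_max) (isolate_var ord_max)).
- exact: restore_varK.
- exact: isolate_varK.
- exact: factorial_poly.
Qed.

Section MpolySupport.
Variables (n : nat) (R : idomainType).
Implicit Types (p : {mpoly R[n]}) (m : 'X_{1..n}).

Lemma msize_leP p k :
  (forall m, p@_m != 0 -> (mdeg m < k)%N) -> (msize p <= k)%N.
Proof.
move=> H; rewrite msizeE; apply/bigmax_leqP_seq => m mp _.
by apply: H; rewrite -mcoeff_msupp.
Qed.

Lemma mcoeff_msize0 p m : (msize p <= mdeg m)%N -> p@_m = 0.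
Proof. by move/msize_mdeg_ge/memN_msupp_eq0. Qed.

Lemma msize_mderiv p i : (msize p^`M(i) <= (msize p).-1)%N.
Proof.
apply: msize_leP => m; rewrite mcoeff_deriv; apply: contraNltn => lepm.
rewrite mcoeff_msize0 ?mul0rn // mdegD mdeg1 addn1.
by rewrite (leq_trans (leqSpred _)) // ltnS.
Qed.

Lemma mderivXU i j : ('X_j : {mpoly R[n]})^`M(i) = (j == i)%:R.
Proof.
rewrite mderivX mnm1E; case: eqVneq => [->|_]; last by rewrite scale0r.
rewrite scale1r (_ : U_(i) - U_(i) = 0)%MM ?mpolyX0 //.
by apply/mnmP => l; rewrite mnmBE subnn mnm0E.
Qed.

Hypothesis charR : [pchar R] =i pred0.

Lemma mderiv_eq0_const p : (forall i, p^`M(i) = 0) -> p = (p@_0%MM)%:MP.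
Proof.
move=> dp0; apply/mpolyP => m; rewrite mcoeffC.
case: eqVneq => [<-|m0]; rewrite ?mulr1 // mulr0.
have /existsP[i mi] : [exists i, m i != 0%N].
  apply: contraNT m0 => /existsPn m0; apply/eqP/mnmP => i.
  by have /negPn/eqP -> := m0 i; rewrite mnm0E.
have := mcoeff_deriv i (m - U_(i))%MM p; rewrite dp0 mcoeff0 submK; last first.
  by rewrite lep1mP.
by move/esym/eqP; rewrite -mulr_natr mulf_eq0 ((pcharf0P R).1 charR) orbF => /eqP.
Qed.

End MpolySupport.

(** * Derivations acting on the coefficients *)

Section CoefficientDerivation.
Variables (n : nat) (A : idomainType) (D : {additive A -> A}).
Hypothesis DM : forall a b, D (a * b) = D a * b + a * D b.
Implicit Types F G : {mpoly A[n]}.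

Lemma map_derM F G : map_mpoly D (F * G)
  = map_mpoly D F * G + F * map_mpoly D G.
Proof.
apply/mpolyP => m; rewrite mcoeff_map_mpoly mcoeffD !mcoeffM raddf_sum.
rewrite -big_split /=; apply: eq_bigr => k _.
by rewrite DM !mcoeff_map_mpoly.
Qed.

Lemma map_der_mderiv i F : map_mpoly D F^`M(i) = (map_mpoly D F)^`M(i).
Proof.
by apply/mpolyP => m; rewrite mcoeff_deriv !mcoeff_map_mpoly mcoeff_deriv raddfMn.
Qed.

Lemma msize_map_der F : (msize (map_mpoly D F) <= msize F)%N.
Proof.
apply: msize_leP => m; rewrite mcoeff_map_mpoly; apply: contraNltn => ltm.
by rewrite mcoeff_msize0 // raddf0.
Qed.

(** The chain rule for [F(q, t(q))]: [D] sees the coefficients of [F] and the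
    coordinates of the point [t] at which [F] is evaluated. *)
Lemma der_meval (t : 'I_n -> A) F :
  D F.@[t] = (map_mpoly D F).@[t] + \sum_i D (t i) * F^`M(i).@[t].
Proof.
have D1 : D 1 = 0.
  by apply: (addIr (D 1)); rewrite add0r -{3}[1]mulr1 DM mulr1 mul1r.
elim/mpoly_ring_ind: F => [c|i|F G FE GE|F G FE GE].
- rewrite map_mpolyC !mevalC big1 ?addr0 // => i _.
  by rewrite mderivC meval0 mulr0.
- have -> : map_mpoly D 'X_i = 0.
    apply/mpolyP => m; rewrite mcoeff_map_mpoly mcoeffX mcoeff0.
    by case: (_ == _); rewrite ?D1 ?raddf0.
  rewrite mevalXU meval0 add0r (bigD1 i) //= mderivXU eqxx meval1 mulr1.
  rewrite big1 ?addr0 // => j ne.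
  by rewrite mderivXU eq_sym (negPf ne) meval0 mulr0.
- rewrite mevalD raddfD FE GE [map_mpoly D (F + G)]raddfD mevalD addrACA -big_split /=.
  by congr (_ + _); apply: eq_bigr => i _; rewrite mderivD mevalD mulrDr.
- rewrite mevalM DM FE GE map_derM mevalD !mevalM.
  have -> : \sum_i D (t i) * ((F * G)^`M(i)).@[t] =
      (\sum_i D (t i) * F^`M(i).@[t]) * G.@[t]
      + F.@[t] * (\sum_i D (t i) * G^`M(i).@[t]).
    rewrite mulr_suml mulr_sumr -big_split /=; apply: eq_bigr => i _.
    by rewrite mderivM mevalD !mevalM; ring.
  by ring.
Qed.

Variable t : 'I_n -> A.

(** With [A] the functions of [q] and [t] the tautological point [p = q], this
    says that [F(p, .)] vanishes to infinite order at [q = p] along the orbit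
    of [D] through that point. *)
Definition flat_along F := forall k, (iter k (map_mpoly D) F).@[t] = 0.

Lemma flat_along1 : ~ flat_along 1.
Proof. by move/(_ 0)/eqP; rewrite /= meval1 oner_eq0. Qed.

Lemma iter_derD k F G : iter k (map_mpoly D) (F + G)
  = iter k (map_mpoly D) F + iter k (map_mpoly D) G.
Proof. by elim: k => //= k ->; rewrite raddfD. Qed.

Lemma flat_along_der F : flat_along F -> flat_along (map_mpoly D F).
Proof. by move=> fF k; rewrite -iterSr; apply: fF. Qed.

Lemma flat_along_mull F G : flat_along G -> flat_along (F * G).
Proof.
move=> flatG k; elim: k F G flatG => [|k IH] F G flatG.
  by rewrite /= mevalM (flatG 0%N) mulr0.
by rewrite iterSr map_derM iter_derD mevalD !IH ?addr0 //; apply: flat_along_der.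
Qed.

End CoefficientDerivation.

(** * Flat polynomials *)
Section FlatPrime.
Variables (n : nat) (A : idomainType) (D : {additive A -> A}) (t : 'I_n -> A).
Hypothesis DM : forall a b, D (a * b) = D a * b + a * D b.
Hypothesis charA : [pchar A] =i pred0.
Implicit Types F G : {mpoly A[n]}.
Local Notation iterD k := (iter k (map_mpoly D)).

Lemma iter_derM k F G : iterD k (F * G)
  = \sum_(i < k.+1) (iterD (k - i) F * iterD i G) *+ 'C(k, i).
Proof.
elim: k => [|k IH]; first by rewrite big_ord_recl big_ord0 addr0.
rewrite iterS IH raddf_sum /=.
under eq_bigr => i _.
  rewrite raddfMn /= (map_derM DM) -!iterS mulrnDl -subSn; last by rewrite -ltnS.
  over.
rewrite big_split /=; apply/esym.
rewrite big_ord_recl [X in _ = X + _]big_ord_recl /= ?bin0 ?subn0 -addrA.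
congr (_ + _).
rewrite [X in _ = _ + X]big_ord_recr /= subnn binn.
rewrite big_ord_recr /= subnn binn addrA; congr (_ + _).
rewrite -big_split /=; apply: eq_bigr => i _.
by rewrite /bump /= !add1n binS mulrnDr subSS addrC; congr (_ + _).
Qed.

(** If [a] and [b] are the orders of vanishing of [F] and [G] along the orbit,
    only one term of Leibniz' formula for [D^(a + b) (F G)] does not vanish,
    and its binomial coefficient is nonzero in characteristic zero. *)
Lemma flat_along_prime F G :
  flat_along D t (F * G) -> flat_along D t F \/ flat_along D t G.
Proof.
move=> fFG; apply: contrapT => /not_orP[/existsNP nF /existsNP nG].
have {nF} exF : exists k, (iterD k F).@[t] != 0.
  by case: nF => k /eqP; exists k.
have {nG} exG : exists k, (iterD k G).@[t] != 0.
  by case: nG => k /eqP; exists k.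
case: (ex_minnP exF) => a Fa mina; case: (ex_minnP exG) => b Gb minb.
have := fFG (a + b)%N; rewrite iter_derM raddf_sum /=.
have ltb : (b < (a + b).+1)%N by rewrite ltnS leq_addl.
rewrite (bigD1 (Ordinal ltb)) //= addnK big1 ?addr0 => [|i neib].
  rewrite mevalMn mevalM => /eqP; rewrite -mulr_natr !mulf_eq0.
  rewrite ((pcharf0P A).1 charA) (negPf Fa) (negPf Gb) /= -leqn0 leqNgt.
  by rewrite bin_gt0 leq_addl.
rewrite mevalMn mevalM; have [ltib|leib] := ltnP i b.
  have -> : (iterD i G).@[t] = 0.
    by apply/eqP; apply: contraTT ltib => /minb; rewrite -leqNgt.
  by rewrite -mulr_natr mulr0 mul0r.
have ltbi : (b < i)%N by rewrite ltn_neqAle leib andbT eq_sym.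
have -> : (iterD (a + b - i) F).@[t] = 0.
  apply/eqP; apply: contraTT ltbi => /mina; rewrite -leqNgt.
  by move: (ltn_ord i); clear; lia.
by rewrite -mulr_natr !mul0r.
Qed.

Lemma flat_along_prime_factor F : factorial_ring {mpoly A[n]} -> F != 0 ->
  flat_along D t F ->
  exists G, [/\ prime_elt G, flat_along D t G & dvdr G F].
Proof.
move=> factS F0 fF; have [u [s [uU sP FE]]] := factS _ F0.
have [G Gs fG] : exists2 G, G \in s & flat_along D t G.
  move: fF; rewrite FE; clear -DM charA uU; elim: s => [|q s IH].
    rewrite big_nil mulr1 => fu; case: (@flat_along1 _ _ D t).
    by rewrite -(mulVr uU); apply: flat_along_mull.
  rewrite big_cons mulrCA => /flat_along_prime[fq|/IH[G Gs fG]].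
    by exists q; rewrite ?mem_head.
  by exists G; rewrite // inE Gs orbT.
exists G; split=> //; first exact: sP.
exists (u * \prod_(p <- rem G s) p).
by rewrite FE (big_rem G Gs) /= -mulrA [_ * G]mulrC.
Qed.

End FlatPrime.

Section FlatIdeal.
Variables (n : nat) (A : idomainType) (I : Type) (D : I -> {additive A -> A}).
Variable t : 'I_n -> A.
Hypothesis DM : forall i a b, D i (a * b) = D i a * b + a * D i b.
Implicit Types F G : {mpoly A[n]}.

(** Flatness along several derivations: every word in the [D i] is allowed, as
    the derivations need not commute. *)
Definition flat F :=
  forall w : seq I, (foldr (fun i => map_mpoly (D i)) F w).@[t] = 0.

Lemma flat_meval F : flat F -> F.@[t] = 0.
Proof. by move/(_ [::]). Qed.

Lemma flat_der i F : flat F -> flat (map_mpoly (D i) F).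
Proof. by move=> fF w; have := fF (rcons w i); rewrite foldr_rcons. Qed.

Lemma foldr_derD w F G : foldr (fun i => map_mpoly (D i)) (F + G) w =
  foldr (fun i => map_mpoly (D i)) F w + foldr (fun i => map_mpoly (D i)) G w.
Proof. by elim: w => //= i w ->; rewrite raddfD. Qed.

Lemma flatD F G : flat F -> flat G -> flat (F + G).
Proof. by move=> fF fG w; rewrite foldr_derD mevalD fF fG addr0. Qed.

Lemma flat_mull F G : flat G -> flat (F * G).
Proof.
move=> flatG w; elim/last_ind: w F G flatG => [|w i IH] F G flatG.
  by rewrite /= mevalM (flat_meval flatG) mulr0.
rewrite foldr_rcons (map_derM (DM i)) foldr_derD mevalD !IH ?addr0 //.
exact: flat_der.
Qed.

Hypothesis charA : [pchar A] =i pred0.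
Variables (a b : I) (i j : 'I_n).
Hypothesis indep : D a (t i) * D b (t j) - D a (t j) * D b (t i) != 0.

(** Differentiating [F = 0] and [D F = 0] along the diagonal with the chain rule
    shows that the differential of [F] at [t] vanishes on the vectors [D a t]
    and [D b t]; their independence makes it vanish.  The partial derivatives commute
    with the action on coefficients, so the same holds for all words. *)
Lemma flat_mderiv F : (forall l, l != i -> l != j -> F^`M(l) = 0) ->
  flat F -> flat F^`M(i) /\ flat F^`M(j).
Proof.
have neij : i != j.
  by apply: contraNneq indep => ->; rewrite mulrC subrr.
have foldr_mderiv l w G : (foldr (fun i => map_mpoly (D i)) G w)^`M(l)
    = foldr (fun i => map_mpoly (D i)) G^`M(l) w.
  by elim: w => //= x w IH; rewrite -map_der_mderiv IH.
move=> dF0 fF.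
have foldr0 w : foldr (fun i => map_mpoly (D i)) 0 w = 0 :> {mpoly A[n]}.
  by elim: w => //= x w ->; rewrite raddf0.
have twovars c G : (forall l, l != i -> l != j -> G^`M(l) = 0) -> flat G ->
    D c (t i) * G^`M(i).@[t] + D c (t j) * G^`M(j).@[t] = 0.
  move=> dG0 fG; have := der_meval (DM c) t G.
  rewrite (flat_meval fG) (flat_meval (flat_der c fG)) raddf0 add0r.
  rewrite (bigD1 i) //= (bigD1 j) 1?eq_sym //= big1 ?addr0 // => l /andP[li lj].
  by rewrite dG0 // meval0 mulr0.
have grad0 G : (forall l, l != i -> l != j -> G^`M(l) = 0) -> flat G ->
    G^`M(i).@[t] = 0 /\ G^`M(j).@[t] = 0.
  move=> dG0 fG; have Ea := twovars a G dG0 fG; have Eb := twovars b G dG0 fG.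
  split; apply: (mulfI indep); rewrite mulr0.
    transitivity (D b (t j) * (D a (t i) * G^`M(i).@[t] + D a (t j) * G^`M(j).@[t])
     - D a (t j) * (D b (t i) * G^`M(i).@[t] + D b (t j) * G^`M(j).@[t])).
      by ring.
    by rewrite Ea Eb !mulr0 subrr.
  transitivity (D a (t i) * (D b (t i) * G^`M(i).@[t] + D b (t j) * G^`M(j).@[t])
     - D b (t i) * (D a (t i) * G^`M(i).@[t] + D a (t j) * G^`M(j).@[t])).
    by ring.
  by rewrite Ea Eb !mulr0 subrr.
split=> w; rewrite -foldr_mderiv.
  apply: (grad0 _ _ _).1 => [l li lj|w'].
    by rewrite foldr_mderiv dF0 // foldr0.
  by rewrite -foldr_cat.
apply: (grad0 _ _ _).2 => [l li lj|w'].
  by rewrite foldr_mderiv dF0 // foldr0.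
by rewrite -foldr_cat.
Qed.

(** Descent on the degree: the partial derivatives of [F] are flat again, hence
    zero, so [F] is constant, and a flat constant is zero. *)
Lemma flat_two_vars_eq0 F :
  (forall l, l != i -> l != j -> F^`M(l) = 0) -> flat F -> F = 0.
Proof.
have [k] := ubnP (msize F); elim: k F => // k IH F ltk dF0 fF.
have [->//|F0] := eqVneq F 0.
have sF0 : (0 < msize F)%N by rewrite lt0n msize_poly_eq0.
have [fi fj] := flat_mderiv dF0 fF.
have ltd l : (msize F^`M(l) < k)%N.
  by apply: leq_ltn_trans (msize_mderiv _ _) _; move: ltk sF0; clear; lia.
have dl0 l : F^`M(l) = 0.
  have [->|li] := eqVneq l i.
    by apply: IH => // l' l'i l'j; rewrite mderiv_comm dF0 ?mderiv0.
  have [->|lj] := eqVneq l j; last exact: dF0.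
  by apply: IH => // l' l'i l'j; rewrite mderiv_comm dF0 ?mderiv0.
have FC := mderiv_eq0_const charA dl0.
by have := flat_meval fF; rewrite FC mevalC => ->; rewrite mpolyC0.
Qed.

End FlatIdeal.

(** * Factors of eigenvectors of a derivation *)
Section DerivationOfFactors.
Variables (T : idomainType) (D : {additive T -> T}).
Hypothesis DM : forall a b, D (a * b) = D a * b + a * D b.
Hypothesis natU : forall k, (k.+1%:R : T) \is a GRing.unit.
Hypothesis factT : factorial_ring T.

Lemma derX p k : D (p ^+ k) = (p ^+ k.-1 * D p) *+ k.
Proof.
elim: k => [|k IH].
  rewrite expr0 mulr0n; apply: (addIr (D 1)).
  by rewrite add0r -{3}[1]mulr1 DM mulr1 mul1r.
rewrite exprS DM IH; case: k {IH} => [|k] /=.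
  by rewrite mulr0n mulr0 addr0 expr0 mul1r mulr1.
by rewrite [in RHS]mulrS mulrnAr mulrA -exprS [D p * _]mulrC.
Qed.

(** Writing [f = p^(k+1) h] with [p] prime to [h], the term of [D f] of lowest
    order in [p] is [(k+1) p^k h (D p)], and [p^(k+1)] divides [D f]. *)
Lemma prime_dvd_der p f : prime_elt p -> f != 0 -> dvdr p f ->
  dvdr f (D f) -> dvdr p (D p).
Proof.
move=> pP f0 pf [c Df]; have [p0 pU pM] := pP.
have [[|k] [h [fE nh]]] := prime_multiplicity factT pP f0.
  by case: nh; rewrite fE expr0 mul1r in pf.
have : dvdr p (k.+1%:R * D p * h).
  exists (c * h - D h); apply: (mulfI (expf_neq0 k p0)).
  have := Df; rewrite fE DM derX /= => E.
  transitivity ((p ^+ k * D p) *+ k.+1 * h + p ^+ k.+1 * D h - p ^+ k.+1 * D h).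
    by rewrite addrK -mulr_natr; ring.
  by rewrite E exprS; ring.
case/pM => //; case/pM => // pk; case/negP: pU.
exact: dvdr_unit pk (natU k).
Qed.

End DerivationOfFactors.

Section EigenFactors.
Variables (n : nat) (A : idomainType) (D : {additive A -> A}).
Hypothesis DM : forall a b, D (a * b) = D a * b + a * D b.
Implicit Types F G H : {mpoly A[n]}.

Lemma map_der_prime_factor G F c : (forall k, (k.+1%:R : A) \is a GRing.unit) ->
  factorial_ring {mpoly A[n]} -> prime_elt G -> F != 0 -> dvdr G F ->
  map_mpoly D F = c *: F -> dvdr G (map_mpoly D G).
Proof.
move=> natU factS primeG F0 GF DF.
apply: (prime_dvd_der (D := map_mpoly D) _ _ factS primeG F0 GF).
- exact: map_derM.
- move=> k; rewrite -(mpolyC_nat n A k.+1); exact: (rmorph_unit (@mpolyC n A)).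
- by exists c%:MP; rewrite mul_mpolyC.
Qed.

Lemma map_der_cofactor G H a c : G != 0 -> map_mpoly D G = a *: G ->
  map_mpoly D (H * G) = c *: (H * G) -> map_mpoly D H = (c - a) *: H.
Proof.
move=> G0 DG; rewrite (map_derM DM) DG => /(canRL (addrK _)) E.
apply: (mulIf G0); rewrite E -!mul_mpolyC mpolyCB; ring.
Qed.

End EigenFactors.

(** * Multiples of a flat prime *)
Section Elimination.
Variables (B S : idomainType).
Variables (f : {rmorphism S -> {poly B}}) (g : {rmorphism {poly B} -> S}).
Hypotheses (fK : cancel f g) (gK : cancel g f).

(** A prime [p] and a non-multiple [q] of [p] are coprime as polynomials in the
    isolated variable, so Bezout's relation eliminates this variable. *)
Lemma prime_elimination p q : prime_elt p ->
  dvdr p q \/ exists c u v, c != 0 /\ g c%:P = u * p + v * q.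
Proof.
move=> [p0 _ pP].
have [->|q0] := eqVneq q 0; first by left; exact: dvdr0.
have fp0 : f p != 0 by rewrite -(rmorph0 f) (can_eq fK).
have fq0 : f q != 0 by rewrite -(rmorph0 f) (can_eq fK).
case: (boolP (coprimep (f p) (f q))) => [|ncop].
  case/Bezout_coprimepP=> -[u v] /= /eqpP[[c1 c2] /= /andP[c10 c20]].
  rewrite -mul_polyC alg_polyC => /(congr1 g).
  rewrite rmorphM rmorphD !rmorphM !fK mulrDr !mulrA => E.
  by right; exists c2, (g c1%:P * g u), (g c1%:P * g v).
left; have /(Bezout_coprimepPn fp0 fq0)[[u v] /= /andP[_ /andP[v0 ltv]] E] := ncop.
have : dvdr p (g v * q).
  by exists (g u); have := congr1 g E; rewrite !rmorphM !fK.
case/pP => // -[w /(congr1 f)]; rewrite gK rmorphM => vE.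
have w0 : f w != 0.
  by apply: contraTneq v0 => w0; rewrite vE w0 mul0r size_poly0.
move: ltv; rewrite vE size_mul //; move: w0; rewrite -size_poly_gt0.
by case: (size (f w)) => // m _; rewrite addSn /= ltnNge leq_addl.
Qed.

End Elimination.

Section FlatDivisibility.
Variables (n : nat) (A : idomainType) (I : Type) (D : I -> {additive A -> A}).
Variable t : 'I_n.+1 -> A.
Hypothesis DM : forall i a b, D i (a * b) = D i a * b + a * D i b.
Hypothesis charA : [pchar A] =i pred0.
Variables (a b : I) (i j k : 'I_n.+1).
Hypothesis indep : D a (t i) * D b (t j) - D a (t j) * D b (t i) != 0.
Hypothesis ijk : forall l, l != i -> l != j -> l = k.

(** Otherwise elimination of the variable [k] between [G] and [F] produces a
    nonzero flat polynomial in the two variables [i] and [j]. *)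
Lemma flat_prime_dvd (G F : {mpoly A[n.+1]}) :
  prime_elt G -> flat D t G -> flat D t F -> dvdr G F.
Proof.
move=> primeG fG fF.
have := @prime_elimination {mpoly A[n]} {mpoly A[n.+1]} (isolate_var k)
  (restore_var k) (@isolate_varK n A k) (@restore_varK n A k) G F primeG.
case=> // -[c [u [v [c0 uvE]]]].
have E : skip_var k c = u * G + v * F.
  by rewrite -uvE; apply/esym; exact: restore_varC.
have fl : flat D t (skip_var k c).
  by rewrite E; apply: flatD; apply: flat_mull.
have skip0 : skip_var k c = 0.
  apply: (flat_two_vars_eq0 DM charA indep) => // l li lj.
  by rewrite (ijk li lj) mderiv_skip_var.
have := isolate_skip k c; rewrite skip0 rmorph0 => /esym/eqP.
by rewrite polyC_eq0 (negPf c0).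
Qed.

End FlatDivisibility.

(** * Vector fields and Euler's relation *)
Section ActAdditive.
Variables (K : fieldType) (X : vfield K).

Lemma act_is_zmod_morphism : zmod_morphism (act X).
Proof.
move=> p q; rewrite /act -sumrB; apply: eq_bigr => i _.
by rewrite mderivB mulrBr.
Qed.

HB.instance Definition _ :=
  GRing.isZmodMorphism.Build {mpoly K[3]} {mpoly K[3]} (act X)
    act_is_zmod_morphism.

Lemma actX i : act X 'X_i = X i.
Proof.
rewrite /act (bigD1 i) //= mderivXU eqxx mulr1 big1 ?addr0 // => j ne.
by rewrite mderivXU eq_sym (negPf ne) mulr0.
Qed.

Lemma actZ c p : act X (c *: p) = c *: act X p.
Proof.
rewrite /act scaler_sumr; apply: eq_bigr => i _.
by rewrite mderivZ scalerAr.
Qed.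

End ActAdditive.

Section Homogeneous.
Variable K : fieldType.
Hypothesis charK : [pchar K] =i pred0.
Implicit Types (P Q : {mpoly K[3]}).

Lemma nat_inj (k l : nat) : k%:R = l%:R :> K -> k = l.
Proof.
have wlog k' l' : (k' <= l')%N -> k'%:R = l'%:R :> K -> k' = l'.
  move=> le /esym/eqP; rewrite -subr_eq0 -natrB // ((pcharf0P K).1 charK).
  by rewrite subn_eq0 => le'; apply/eqP; rewrite eqn_leq le.
by case: (leqP k l) => [/wlog //|/ltnW le /esym/wlog ->].
Qed.

Lemma natr_mpoly_unit n k : (k.+1%:R : {mpoly K[n]}) \is a GRing.unit.
Proof.
rewrite -(mpolyC_nat n K k.+1); apply: (rmorph_unit (@mpolyC n K)).
by rewrite unitfE ((pcharf0P K).1 charK).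
Qed.

Lemma pchar_mpoly n : [pchar {mpoly K[n]}] =i pred0.
Proof.
apply/pcharf0P => -[|k]; first by rewrite !eqxx.
by apply/negbTE/eqP => k0; have := natr_mpoly_unit n k; rewrite k0 unitr0.
Qed.

Lemma dhomog_coefP k P :
  reflect (forall m, P@_m != 0 -> mdeg m = k) (P \is k.-homog).
Proof.
apply: (iffP (dhomogP _ _ _)) => H m; first by rewrite -mcoeff_msupp; apply: H.
by rewrite mcoeff_msupp; apply: H.
Qed.

Definition radial : vfield K := fun i => 'X_i.

Lemma mcoeff_radial P m : (act radial P)@_m = P@_m *+ mdeg m.
Proof.
elim/mpolyind: P => [|c m' P _ _ IH]; first by rewrite raddf0 mcoeff0 mul0rn.
rewrite raddfD /= mcoeffD IH mcoeffD mulrnDl; congr (_ + _).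
have -> : act radial (c *: 'X_[m']) = (c *+ mdeg m') *: 'X_[m'].
  rewrite actZ /act mdegE -mulr_natr natr_sum mulr_sumr scaler_suml scaler_sumr.
  apply: eq_bigr => i _; rewrite mderivX.
  have [->|mi] := eqVneq (m' i) 0%N; first by rewrite scale0r mulr0 scaler0 mulr0 scale0r.
  by rewrite -scalerAr -mpolyXD addmC submK ?lep1mP // scalerA.
by rewrite !mcoeffZ mulrnAl mcoeffX; case: eqVneq => [->//|]; rewrite mulr0 !mul0rn.
Qed.
End Homogeneous.

(** Applied to derivatives [H] of [F]: by degree, their cofactors are constant. *)
Lemma dvdr_msize n (R : idomainType) (F H : {mpoly R[n]}) :
  F != 0 -> dvdr F H -> (msize H <= msize F)%N -> exists c, H = c *: F.
Proof.
move=> F0 [N ->]; have [->|N0] := eqVneq N 0; first by exists 0; rewrite mul0r scale0r.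
rewrite msizeM // => le; exists N@_0%MM.
have le1 : (msize N <= 1)%N.
  have : (0 < msize F)%N by rewrite lt0n msize_poly_eq0.
  by move: le; clear; lia.
by rewrite {1}(msize1_polyC le1) mul_mpolyC.
Qed.

Section Euler.
Variable K : fieldType.
Hypothesis charK : [pchar K] =i pred0.
Implicit Types (P Q : {mpoly K[3]}).

Lemma radial_dhomog k P : P \is k.-homog -> act (@radial K) P = k%:R *: P.
Proof.
move/dhomog_coefP => H; apply/mpolyP => m.
rewrite mcoeff_radial mcoeffZ mulr_natl.
by have [->|/H->//] := eqVneq P@_m 0; rewrite !mul0rn.
Qed.

Lemma radial_eigen c P : P != 0 -> act (@radial K) P = c *: P ->
  exists k, c = k%:R /\ P \is k.-homog.
Proof.
move=> P0 E; have cE m : P@_m != 0 -> (mdeg m)%:R = c.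
  move=> Pm; apply: (mulIf Pm); have := congr1 (mcoeff m) E.
  by rewrite mcoeff_radial mcoeffZ mulr_natl.
have [m Pm] : exists m, P@_m != 0.
  by exists (mlead P); rewrite mleadc_eq0.
exists (mdeg m); rewrite cE //; split=> //; apply/dhomog_coefP => m' Pm'.
by apply: (nat_inj charK); rewrite !cE.
Qed.

Lemma dhomog_mderiv k P i : P \is k.-homog -> P^`M(i) \is k.-1.-homog.
Proof.
move/dhomog_coefP => H; apply/dhomog_coefP => m; rewrite mcoeff_deriv => nz.
have /H <- : P@_(m + U_(i)) != 0 by apply: contraNneq nz => ->; rewrite mul0rn.
by rewrite mdegD mdeg1 addn1.
Qed.

Lemma dhomog_act (X : vfield K) m k P : (forall i, X i \is m.-homog) ->
  P \is k.-homog -> act X P \is (m + k.-1).-homog.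
Proof.
by move=> hX hP; apply: rpred_sum => i _; apply: dhomogM => //; apply: dhomog_mderiv.
Qed.

Lemma msize_act_radial P : (msize (act (@radial K) P) <= msize P)%N.
Proof.
apply: msize_leP => m; rewrite mcoeff_radial; apply: contraNltn => ltm.
by rewrite mcoeff_msize0 // mul0rn.
Qed.

(** The cofactor is a constant by degree, so [P] is an eigenvector of the radial
    derivation, and by Euler's relation the eigenspaces of the latter are the
    spaces of homogeneous polynomials. *)
Lemma radial_dvd_dhomog P : P != 0 -> dvdr P (act (@radial K) P) ->
  exists k, P \is k.-homog.
Proof.
move=> P0 /(dvdr_msize P0)/(_ (msize_act_radial P))[c cE].
by have [k [_ hk]] := radial_eigen P0 cE; exists k.
Qed.

Lemma factorial_mpoly3 : factorial_ring {mpoly K[3]}.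
Proof. exact/factorial_mpoly/factorial_field. Qed.

Lemma prime_factor_dhomog p P k : prime_elt p -> P != 0 -> P \is k.-homog ->
  dvdr p P -> exists l, p \is l.-homog.
Proof.
move=> pP P0 hP pdP; have [p0 _ _] := pP; apply: radial_dvd_dhomog => //.
apply: (prime_dvd_der (D := act (@radial K)) _ _ factorial_mpoly3 pP P0) => //.
- exact: actM.
- exact: natr_mpoly_unit.
- by rewrite /= (radial_dhomog hP); exists k%:R%:MP; rewrite mul_mpolyC.
Qed.

Lemma dhomog_cofactor p P k l : p != 0 -> P != 0 ->
  p \is l.-homog -> P * p \is k.-homog ->
  exists l', P \is l'.-homog /\ (l' + l)%N = k.
Proof.
move=> p0 P0 hp hPp.
have E : act (@radial K) P = (k%:R - l%:R) *: P.
  apply: (mulIf p0); have := radial_dhomog hPp.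
  rewrite actM (radial_dhomog hp) => /(canRL (addrK _)) ->.
  by rewrite -!scalerAl -scalerAr scalerBl.
have [l' [lE hP]] := radial_eigen P0 E; exists l'; split=> //.
by apply: (nat_inj charK); rewrite natrD -lE subrK.
Qed.

Notation A := ({mpoly K[3]} : idomainType).

(** Homogeneity in [q] of a polynomial in [p] and [q]. *)
Definition coeff_dhomog n k (F : {mpoly A[n]}) :=
  forall m, (F@_m : {mpoly K[3]}) \is k.-homog.

Lemma map_radial_dhomog n k (F : {mpoly A[n]}) :
  coeff_dhomog k F -> map_mpoly (act (@radial K) : {additive A -> A}) F = k%:R%:MP *: F.
Proof.
move=> hF; apply/mpolyP => m; rewrite mcoeff_map_mpoly mcoeffZ /= mul_mpolyC.
exact: radial_dhomog.
Qed.

(** [D] does not raise the degree in [p], so the cofactor [c] depends on [q]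
    only and is common to all coefficients. *)
Lemma map_der_eigen n (D : {additive A -> A})
    (F : {mpoly A[n]}) :
  F != 0 -> dvdr F (map_mpoly D F) ->
  exists c, forall m, D F@_m = c * F@_m.
Proof.
move=> F0 /(dvdr_msize F0)/(_ (msize_map_der _ _))[c cE]; exists c => m.
by rewrite -mcoeff_map_mpoly cE mcoeffZ.
Qed.

Lemma map_radial_dvd_dhomog n (F : {mpoly A[n]}) :
  F != 0 -> dvdr F (map_mpoly (act (@radial K) : {additive A -> A}) F) ->
  exists k, coeff_dhomog k F.
Proof.
move=> F0 /(map_der_eigen F0)[c cE].
have degF m : F@_m != 0 -> exists k, F@_m \is k.-homog /\ c = k%:R%:MP.
  move=> Fm; have [|k hk] := radial_dvd_dhomog Fm; first by exists c; rewrite -cE.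
  exists k; split=> //; apply: (mulIf Fm); rewrite -cE mul_mpolyC.
  exact: radial_dhomog.
have [k [_ ck]] : exists k, F@_(mlead F) \is k.-homog /\ c = k%:R%:MP.
  by apply: degF; rewrite mleadc_eq0.
exists k => m; have [->|Fm] := eqVneq F@_m 0; first exact: dhomog0.
case: (degF m Fm) => l [hl]; rewrite ck => /eqP; rewrite mpolyC_eq => /eqP /(nat_inj charK) kl.
by rewrite kl.
Qed.

Lemma coeff_dhomogM n k l (F G : {mpoly A[n]}) :
  coeff_dhomog k F -> coeff_dhomog l G -> coeff_dhomog (k + l) (F * G).
Proof.
move=> hF hG m; rewrite mcoeffM; apply: rpred_sum => i _.
exact: dhomogM.
Qed.

End Euler.

(** * First integrals from flat polynomials *)
Lemma mcoeffM_var0 n (R : nzRingType) (Q : {mpoly R[n]}) i (m : 'X_{1..n}) :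
  m i = 0%N -> (Q * 'X_i)@_m = 0.
Proof.
move=> mi; apply: memN_msupp_eq0; rewrite (perm_mem (msuppMX _ _)).
apply/negP => /mapP[m' _ mE]; move: mi.
by rewrite mE mnmDE mnm1E eqxx.
Qed.

(** A monomial of [P] without [X_i] would survive in [P X_j], but not in
    [Q X_i]. *)
Lemma var_factor n (R : nzRingType) (P Q : {mpoly R[n]}) i j :
  i != j -> P * 'X_j = Q * 'X_i -> exists g, P = g * 'X_i.
Proof.
move=> ij E; exists (\sum_(m <- msupp P) P@_m *: 'X_[m - U_(i)]).
rewrite mulr_suml [LHS]mpolyE; apply: eq_big_seq => m; rewrite mcoeff_msupp => Pm.
rewrite -scalerAl -mpolyXD submK // lep1mP; apply: contraNneq Pm => mi.
rewrite -(mcoeffMX P U_(j)%MM) E mcoeffM_var0 //.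
by rewrite mnmDE mi addn0 mnm1E eq_sym (negPf ij).
Qed.

Section FirstIntegral.
Variable K : fieldType.
Notation A := ({mpoly K[3]} : idomainType).
Hypothesis charK : [pchar K] =i pred0.
Variables (X : vfield K) (r : nat).
Hypothesis homogX : forall i, X i \is r.-homog.
Hypothesis not_radial : ~ multiple_of_radial X.

(** If all these minors vanish, [X_i = g x_i] with the same [g] for all [i], and
    [X] is radial. *)
Lemma transverse_to_radial : exists i j, X i * 'X_j - X j * 'X_i != 0.
Proof.
apply: contrapT => /forallNP H.
have E i j : X i * 'X_j = X j * 'X_i.
  apply/eqP; rewrite -subr_eq0; apply: contraPT (H i) => nz Hi.
  by apply: Hi; exists j.
have [g gE] : exists g, X ord0 = g * 'X_ord0.
  by apply: (@var_factor _ _ _ (X ord_max) ord0 ord_max).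
apply: not_radial; exists g => i.
have x0 : 'X_ord0 != 0 :> {mpoly K[3]} by rewrite -msize_poly_eq0 msizeX.
by apply: (mulIf x0); rewrite E gE mulrAC.
Qed.

Lemma third_index (i j : 'I_3) : i != j ->
  exists k, forall l, l != i -> l != j -> l = k.
Proof.
move=> ij; exists (inord (3 - i - j)) => l li lj; apply: val_inj.
have lti := ltn_ord i; have ltj := ltn_ord j; have ltl := ltn_ord l.
by move: ij li lj; rewrite -!val_eqE /= => ij li lj; rewrite inordK; lia.
Qed.

Definition on_diagonal : 'I_3 -> A := fun i => 'X_i.

(** The leaves of the plane are the projections of the surfaces spanned by [X]
    and the radial field, so flatness along both fields is what matters. *)
Definition leaf_der (b : bool) : {additive A -> A} :=
  act (if b then X else @radial K).

Lemma leaf_derM b f g : leaf_der b (f * g) = leaf_der b f * g + f * leaf_der b g.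
Proof. exact: actM. Qed.

(** A polynomial homogeneous in [q] is an eigenvector of the radial field, and
    so are its derivatives along [X]: words involving the radial field bring
    no new condition. *)
Lemma flat_dhomog (F : {mpoly A[3]}) k : coeff_dhomog k F ->
  flat_along (act X) on_diagonal F -> flat leaf_der on_diagonal F.
Proof.
move=> hF fF w.
suff [fw _] : flat_along (act X) on_diagonal
      (foldr (fun b => map_mpoly (leaf_der b)) F w)
    /\ exists k, coeff_dhomog k (foldr (fun b => map_mpoly (leaf_der b)) F w).
  exact: (fw 0%N).
elim: w => [|b w [fw [l hl]]] /=; first by split=> //; exists k.
case: b => /=; split.
- exact: flat_along_der.
- exists (r + l.-1)%N => m; rewrite mcoeff_map_mpoly; exact: dhomog_act.
- rewrite (map_radial_dhomog hl) -mul_mpolyC; apply: flat_along_mull => //.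
  exact: actM.
- exists l => m; rewrite (map_radial_dhomog hl) mcoeffZ mul_mpolyC.
  exact/dhomogZ.
Qed.

(** All coefficients of a flat prime factor [G] of [Phi], as a polynomial in
    [p], have the same cofactor for [X], and they cannot all be proportional
    to one [Q]: then [G] would be [Q(q) c(p)], which does not vanish on the
    diagonal. *)
Lemma flat_first_integral (Phi : {mpoly A[3]}) d :
    Phi != 0 -> coeff_dhomog d Phi ->
    flat_along (act X) on_diagonal Phi ->
  exists k P Q, [/\ (k <= d)%N, P \is k.-homog, Q \is k.-homog,
    forall c : K, P != c *: Q & Q != 0 /\ act X P * Q = P * act X Q].
Proof.
move=> Phi0 hPhi fPhi.
have factS : factorial_ring {mpoly A[3]}.
  exact/factorial_mpoly/factorial_mpoly3.
have charA : [pchar A] =i pred0 by exact: pchar_mpoly.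
have [G [primeG fG GPhi]] :=
  flat_along_prime_factor (@actM _ X) charA factS Phi0 fPhi.
have [G0 _ _] := primeG.
have [H HE] := GPhi.
have H0 : H != 0 by apply: contraNneq Phi0 => H0; rewrite HE H0 mul0r.
have radPhi := map_radial_dhomog hPhi.
have [k hG] : exists k, coeff_dhomog k G.
  apply: (@map_radial_dvd_dhomog K charK 3 G G0).
  exact: (map_der_prime_factor (@actM _ _) (natr_mpoly_unit charK 3) factS
    primeG Phi0 GPhi radPhi).
have radG := map_radial_dhomog hG.
have [l hH] : exists l, coeff_dhomog l H.
  apply: (@map_radial_dvd_dhomog K charK 3 H H0).
  have -> := map_der_cofactor (@actM _ _) G0 radG (etrans (congr1 _ (esym HE))
    (etrans radPhi (congr1 _ HE))).
  by exists (d%:R%:MP - k%:R%:MP)%:MP; rewrite mul_mpolyC.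
have led : (k <= d)%N.
  have hP : coeff_dhomog (l + k) Phi by rewrite HE; exact: coeff_dhomogM.
  have Phim : Phi@_(mlead Phi) != 0 by rewrite mleadc_eq0.
  by rewrite -(dhomog_uniq Phim (hP _) (hPhi _)) leq_addl.
have [i [j indep]] := transverse_to_radial.
have ij : i != j by apply: contraNneq indep => ->; rewrite subrr.
have [n ijn] := third_index ij.
have flG := flat_dhomog hG fG.
have indep' : leaf_der true (on_diagonal i) * leaf_der false (on_diagonal j)
    - leaf_der true (on_diagonal j) * leaf_der false (on_diagonal i) != 0.
  by rewrite /leaf_der /on_diagonal /= !actX.
have GXG : dvdr G (map_mpoly (leaf_der true) G).
  exact: (flat_prime_dvd leaf_derM charA indep' ijn primeG flG (flat_der true flG)).
have [N NE] := map_der_eigen G0 GXG.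
set Q := G@_(mlead G); have Q0 : Q != 0 by rewrite mleadc_eq0.
case: (pselect (exists m, forall c : K, G@_m != c *: Q)) => [[m ncol]|allcol].
  exists k, G@_m, Q; split; [exact: led | exact: hG | exact: hG | exact: ncol | split=> //].
  by have := NE m; have := NE (mlead G); rewrite /= -/Q => -> ->; ring.
have /choice[c cE] : forall m, exists c : K, G@_m = c *: Q.
  move=> m; apply: contrapT => /forallNP nc; apply: allcol; exists m => c.
  exact/eqP.
have := fG 0%N; rewrite /= mevalE => GE.
have E : Q * \sum_(m <- msupp G) c m *: 'X_[m] = 0.
  rewrite -[RHS]GE mulr_sumr; apply: eq_bigr => m _.
  by rewrite cE -scalerAr -scalerAl mpolyXE_id.
have {E} : (\sum_(m <- msupp G) c m *: 'X_[m])@_(mlead G) = 0.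
  by move/eqP: E; rewrite mulf_eq0 (negPf Q0) => /eqP ->; rewrite mcoeff0.
rewrite raddf_sum /= (bigD1_seq (mlead G)) ?mlead_supp ?msupp_uniq //=.
rewrite mcoeffZ mcoeffX eqxx mulr1 big1 ?addr0 => [c0|m ne]; last first.
  by rewrite mcoeffZ mcoeffX (negPf ne) mulr0.
by move: Q0; rewrite /Q cE c0 scale0r eqxx.
Qed.

End FirstIntegral.

(** * The kernel of the extactic matrix *)
Section WronskianKernel.
Variables (A : idomainType) (D : {additive A -> A}) (n : nat) (w : 'I_n -> A).
Hypothesis DM : forall a b, D (a * b) = D a * b + a * D b.

(** Let [r] be the last index occurring in some relation between the rows, so
    that a nonzero multiple of the row [r] is a combination of the previous
    rows.  The vectors [c] killing the rows before [r] kill it too; hence they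
    form a space stable under [D], since
    [(D c) . row_i = D (c . row_i) - c . row_(i+1)].  The same identity then
    shows that they kill every row. *)
Lemma wronskian_kernel :
    \det (\matrix_(i < n, j < n) iter i D (w j)) = 0 ->
  exists C : 'I_n -> A, (exists j, C j != 0)
    /\ forall k, \sum_j C j * iter k D (w j) = 0.
Proof.
set M := \matrix_(i, j) _ => detM.
have [b b0 bM] : exists2 b : 'rV[A]_n, b != 0 & b *m M = 0.
  by apply/det0P; rewrite detM.
have [C C0 CM] : exists2 C : 'rV[A]_n, C != 0 & C *m M^T = 0.
  by apply/det0P; rewrite det_tr detM.
have nz0 (u : 'rV[A]_n) : u != 0 -> exists j, u 0 j != 0.
  move=> u0; apply/existsP; apply: contraNT u0 => /existsPn u0.
  by apply/eqP/rowP => j; rewrite mxE; apply/eqP/negPn/u0.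
have [i0 bi0] := nz0 b b0.
have [r br maxr] : exists2 r, b 0 r != 0 & forall i : 'I_n, (r < i)%N -> b 0 i = 0.
  case: (@arg_maxnP _ i0 (fun i => b 0 i != 0) (fun i => i : nat) bi0) => r br maxr.
  exists r => // i lti; apply/eqP; apply: contraTT lti => /maxr.
  by rewrite -leqNgt.
pose kills (c : 'I_n -> A) k := \sum_j c j * iter k D (w j) = 0.
have killsS c k : kills c k -> kills (D \o c) k -> kills c k.+1.
  rewrite /kills => ck Dck; have := congr1 D ck.
  rewrite raddf0 raddf_sum => E.
  rewrite -[RHS]E -[LHS]add0r -[X in X + _]Dck -big_split /=.
  by apply: eq_bigr => j _; rewrite DM.
have kills_r c : (forall i, (i < r)%N -> kills c i) -> kills c r.
  move=> ci; apply: (mulfI br); rewrite mulr0.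
  have E j : \sum_i b 0 i * iter i D (w j) = 0.
    have := congr1 (fun u : 'rV_n => u 0 j) bM; rewrite !mxE => bMj.
    by apply: etrans bMj; apply: eq_bigr => i _; rewrite mxE.
  have : \sum_i b 0 i * (\sum_j c j * iter i D (w j)) = 0.
    under eq_bigr do rewrite mulr_sumr.
    rewrite exchange_big big1 //= => j _.
    transitivity (c j * \sum_i b 0 i * iter i D (w j)); last by rewrite E mulr0.
    by rewrite mulr_sumr; apply: eq_bigr => i _; rewrite mulrCA.
  rewrite (bigD1 r) //= [X in _ + X]big1 ?addr0 // => i nei.
  have [lti|lei] := ltnP i r; first by rewrite (ci _ lti) mulr0.
  by rewrite maxr ?mul0r // ltn_neqAle lei andbT eq_sym.
have kills_all k c : (forall i, (i < r)%N -> kills c i) -> kills c k.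
  elim: k c => [|k IH] c cr.
    by case: (posnP r) => [r0|/cr//]; move: (kills_r c cr); rewrite r0.
  apply: killsS; first exact: IH.
  apply: IH => i lti; have ci1 : kills c i.+1.
    by move: lti; rewrite leq_eqVlt => /predU1P[->|/cr//]; exact: kills_r.
  have := congr1 D (cr i lti); rewrite raddf0 raddf_sum => E.
  rewrite /kills -[RHS]E -[LHS]addr0 -[X in _ + X]ci1 -big_split /=.
  by apply: eq_bigr => j _; rewrite DM.
exists (fun j => C 0 j); split; first exact: nz0.
move=> k; apply: kills_all => i lti; have ltin := ltn_trans lti (ltn_ord r).
have := congr1 (fun u : 'rV_n => u 0 (Ordinal ltin)) CM; rewrite !mxE => CMi.
by apply: etrans CMi; apply: eq_bigr => j _; rewrite !mxE.
Qed.
End WronskianKernel.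

Lemma meval_lift n (R : idomainType) (p : {mpoly R[n]}) :
  (map_mpoly (@mpolyC n R) p).@[fun i => 'X_i] = p.
Proof.
move: p; apply: (mpoly_hom_eq (f := meval (fun i => 'X_i : {mpoly R[n]})
  \o map_mpoly (@mpolyC n R)) (g := idfun)) => [c|i] /=.
  by rewrite map_mpolyC mevalC.
by rewrite map_mpolyX mevalXU.
Qed.

Section ExtacticKernel.
Variables (K : fieldType) (X : vfield K) (d n : nat).
Notation A := ({mpoly K[3]} : idomainType).
Variables (w : 'I_n -> A).
Hypothesis w_free : forall c : 'I_n -> K, \sum_j c j *: w j = 0 -> forall j, c j = 0.
Hypothesis w_homog : forall j, w j \is d.-homog.

(** For [Phi = sum_j C_j(p) w_j(q)], the restriction of [X^i(Phi)] to the
    diagonal is [sum_j C_j X^i(w_j)]; moreover [Phi <> 0], since the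
    coefficient of a monomial in [p] is a combination of the [w_j] with
    constant coefficients. *)
Lemma extactic_flat :
    \det (\matrix_(i < n, j < n) iter i (act X) (w j)) = 0 ->
  exists Phi : {mpoly A[3]}, [/\ Phi != 0, coeff_dhomog d Phi &
    flat_along (act X) (@on_diagonal K) Phi].
Proof.
move=> /(wronskian_kernel (@actM _ X))[C [[j0 Cj0] CE]].
pose lift : A -> {mpoly A[3]} := map_mpoly (@mpolyC 3 K).
pose Phi : {mpoly A[3]} := \sum_j w j *: lift (C j).
have PhiE m : Phi@_m = \sum_j (C j)@_m *: w j.
  rewrite raddf_sum; apply: eq_bigr => j _.
  by rewrite /= mcoeffZ mcoeff_map_mpoly mulrC mul_mpolyC.
exists Phi; split.
- apply: contraNneq Cj0 => Phi0; apply/eqP/mpolyP => m; rewrite mcoeff0.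
  by apply: (w_free (c := fun j => (C j)@_m)); rewrite -PhiE Phi0 mcoeff0.
- by move=> m; rewrite PhiE; apply: rpred_sum => j _; apply: dhomogZ.
- move=> k.
  have iterE l : iter l (map_mpoly (act X : {additive A -> A})) Phi
      = \sum_j iter l (act X) (w j) *: lift (C j).
    elim: l => // l IH; rewrite iterS IH; apply/mpolyP => m.
    rewrite mcoeff_map_mpoly !raddf_sum; apply: eq_bigr => j _ /=.
    by rewrite !mcoeffZ mcoeff_map_mpoly /= ![_ * _%:MP]mulrC !mul_mpolyC actZ.
  rewrite iterE raddf_sum -[RHS](CE k); apply: eq_bigr => j _ /=.
  rewrite mevalZ mulrC; congr (_ * _).
  exact: meval_lift.
Qed.

End ExtacticKernel.

(** * Reduction to lowest terms, and invariant curves *)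
Section Reduction.
Variable K : fieldType.
Hypothesis charK : [pchar K] =i pred0.

Lemma dhomog0_unit (p : {mpoly K[3]}) : p != 0 -> p \is 0.-homog ->
  p \is a GRing.unit.
Proof.
move=> p0 /dhomog_coefP hp.
have le1 : (msize p <= 1)%N by apply: msize_leP => m /hp ->.
rewrite (msize1_polyC le1); apply: (rmorph_unit (@mpolyC 3 K)).
by rewrite unitfE; apply: contraNneq p0 => p00; rewrite (msize1_polyC le1) p00 mpolyC0.
Qed.

(** A common factor of [P] and [Q] has a prime factor, which is homogeneous; it
    can be cancelled, and this lowers the degree. *)
Lemma coprime_representative (X : vfield K) k (P Q : {mpoly K[3]}) :
    P \is k.-homog -> Q \is k.-homog -> Q != 0 ->
    (forall c : K, P != c *: Q) -> act X P * Q = P * act X Q ->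
  exists l P' Q', [/\ (l <= k)%N, P' \is l.-homog /\ Q' \is l.-homog,
    Q' != 0 /\ coprime_poly P' Q', forall c : K, P' != c *: Q'
    & act X P' * Q' = P' * act X Q'].
Proof.
elim/ltn_ind: k P Q => k IH P Q hP hQ Q0 ncol E.
case: (pselect (coprime_poly P Q)) => [cop|]; first by exists k, P, Q.
move=> /existsNP[D] /not_implyP[DP /not_implyP[DQ /negP DU]].
have D0 : D != 0 by apply: contraNneq Q0 => D0; case: DQ => B ->; rewrite D0 mulr0.
have [p primep pD] := exists_prime_factor (@factorial_mpoly3 K) D0 DU.
have [p0 pU _] := primep.
have [P' PE] : dvdr p P by exact: dvdr_trans pD DP.
have [Q' QE] : dvdr p Q by exact: dvdr_trans pD DQ.
have P0 : P != 0 by have := ncol 0; rewrite scale0r.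
have Q'0 : Q' != 0 by apply: contraNneq Q0 => Q'0; rewrite QE Q'0 mul0r.
have P'0 : P' != 0 by apply: contraNneq P0 => P'0; rewrite PE P'0 mul0r.
have [l hp] : exists l, p \is l.-homog.
  by apply: (prime_factor_dhomog charK primep Q0 hQ); exists Q'.
have l0 : (0 < l)%N.
  by rewrite lt0n; apply: contraNneq pU => l0; apply: dhomog0_unit; rewrite l0 in hp.
rewrite PE in hP; rewrite QE in hQ.
have [l1 [hP' l1E]] := dhomog_cofactor charK p0 P'0 hp hP.
have [l2 [hQ' l2E]] := dhomog_cofactor charK p0 Q'0 hp hQ.
have l12 : l1 = l2 by apply/eqP; rewrite -(eqn_add2r l) l1E l2E.
rewrite -l12 in hQ'.
have [|c||e [P1 [Q1 [le1 H1 H2 H3 H4]]]] := IH l1 _ P' Q' hP' hQ' Q'0.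
- by rewrite -l1E -[X in (X < _)%N]addn0 ltn_add2l.
- by apply: contraNneq (ncol c) => P'E; rewrite PE QE P'E scalerAl.
- apply: (mulIf p0); apply: (mulIf p0).
  move: E; rewrite PE QE !actM => E; apply/eqP; rewrite -subr_eq0.
  have -> : act X P' * Q' * p * p - P' * act X Q' * p * p =
    (act X P' * p + P' * act X p) * (Q' * p)
    - P' * p * (act X Q' * p + Q' * act X p) by ring.
  by rewrite E subrr.
exists e, P1, Q1; split=> //; apply: leq_trans le1 _.
by rewrite -l1E leq_addr.
Qed.

Lemma first_integral_quotient (X : vfield K) l (P Q : {mpoly K[3]}) :
    P \is l.-homog -> Q \is l.-homog -> Q != 0 -> coprime_poly P Q ->
    (forall c : K, P != c *: Q) -> act X P * Q = P * act X Q ->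
  first_integral X l (FracField.tofrac P / FracField.tofrac Q).
Proof.
move=> hP hQ Q0 cop ncol E; split; first by exists P, Q.
  move=> c /(canRL (divfK _)); rewrite tofrac_eq0 => /(_ Q0) /eqP.
  by rewrite -tofracM tofrac_eq mul_mpolyC (negPf (ncol c)).
by rewrite frac_actE // E subrr tofrac0 mul0r.
Qed.

Lemma iter_act_dvd (X : vfield K) (F G : {mpoly K[3]}) i :
  invariant_curve X F -> dvdr F G -> dvdr F (iter i (act X) G).
Proof.
move=> [L LE] FG; elim: i => //= i [H ->].
by exists (act X H + H * L); rewrite actM LE; ring.
Qed.

Section Basis.
Variables (X : vfield K) (d : nat) (v : 'C(d + 2, 2).-tuple (dhomog 3 K d)).
Hypothesis basis_v : basis_of fullv v.
Notation w j := (mpoly_of_dhomog (tnth v j)).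

Lemma dhomog_basis_free (c : 'I_('C(d + 2, 2)) -> K) :
  \sum_j c j *: w j = 0 -> forall j, c j = 0.
Proof.
move=> E; have /freeP/(_ c) := basis_free basis_v; apply; apply: val_inj.
rewrite /= raddf_sum -[RHS]E; apply: eq_bigr => j _ /=.
by rewrite (tnth_nth 0).
Qed.

Lemma dhomog_basis_span (G : {mpoly K[3]}) : G \is d.-homog ->
  exists c : 'I_('C(d + 2, 2)) -> K, G = \sum_j c j *: w j.
Proof.
move=> hG; exists (fun j => coord v j (DHomog hG)).
have := coord_basis basis_v (memvf (DHomog hG)).
move/(congr1 (@mpoly_of_dhomog _ _ _)) => /= {1}->.
rewrite raddf_sum; apply: eq_bigr => j _ /=.
by rewrite (tnth_nth 0).
Qed.

Lemma iter_act_sum N (c : 'I_N -> K) (u : 'I_N -> {mpoly K[3]}) i :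
  iter i (act X) (\sum_j c j *: u j) = \sum_j c j *: iter i (act X) (u j).
Proof.
elim: i => //= i ->; rewrite raddf_sum; apply: eq_bigr => j _.
exact: actZ.
Qed.

(** Multiplying [F] by a power of a coordinate gives [G] of degree exactly [d].
    Cramer's rule expresses [det M] times any coordinate of [G] in the basis
    through the [X^i(G)], which are multiples of [F]. *)
Lemma invariant_curve_dvd_extactic (F : {mpoly K[3]}) k :
    F != 0 -> F \is k.-homog -> (k <= d)%N -> invariant_curve X F ->
  divides F (extactic X v).
Proof.
move=> F0 hF led invF.
pose G := F * 'X_ord0 ^+ (d - k).
have hG : G \is d.-homog.
  rewrite -(subnKC led) /G; apply: dhomogM => //.
  by rewrite -[X in X.-homog]mul1n; apply: dhomogMn; rewrite dhomogX /= mdeg1.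
have G0 : G != 0.
  by rewrite mulf_neq0 // expf_neq0 // -msize_poly_eq0 msizeX.
have [c cE] := dhomog_basis_span hG.
have [j cj] : exists j, c j != 0.
  apply/existsP; apply: contraNT G0 => /existsPn c0; rewrite cE big1 // => j _.
  by have /negPn/eqP -> := c0 j; rewrite scale0r.
set M := \matrix_(i < 'C(d + 2, 2), l < 'C(d + 2, 2)) iter i (act X) (w l).
have E : \det M * (c j)%:MP = \sum_i \adj M j i * iter i (act X) G.
  have := congr1 (fun N : 'M_('C(d + 2, 2)) =>
    (N *m \col_l (c l)%:MP) j 0) (mul_adj_mx M).
  rewrite mul_scalar_mx -mulmxA !mxE => <-; apply: eq_bigr => i _.
  congr (_ * _); rewrite cE iter_act_sum mxE; apply: eq_bigr => l _.
  by rewrite !mxE mulrC mul_mpolyC.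
have dvdM : dvdr F (\det M * (c j)%:MP).
  rewrite E; apply: big_ind => [||i _]; [exact: dvdr0 | exact: dvdrD |].
  apply: dvdr_mull; apply: iter_act_dvd => //.
  by exists ('X_ord0 ^+ (d - k)); rewrite /G mulrC.
case: dvdM => H HE; exists ((c j)^-1%:MP * H).
rewrite -mulrA -HE mulrCA -mpolyCM mulVf // mpolyC1 mulr1 //.
Qed.

End Basis.
End Reduction.

Theorem theorem2 (R : realType) (X : vfield R[i]) (d : nat)
    (hX : represents_P2_vfield X) (hd : (0 < d)%N)
    (v : 'C(d + 2, 2).-tuple (dhomog 3 R[i] d)) (hv : basis_of fullv v) :
  (forall (F : {mpoly R[i][3]}) (k : nat),
      F != 0 -> F \is k.-homog -> (k <= d)%N ->
      invariant_curve X F -> divides F (extactic X v))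
  /\ (extactic X v = 0 ->
      exists (e : nat) (f : {fraction {mpoly R[i][3]}}),
        (e <= d)%N /\ first_integral X e f).
Proof.
split=> [F k|E0]; first exact: invariant_curve_dvd_extactic.
have charC : [pchar R[i]] =i pred0 by exact: Num.Theory.pchar_num.
have [[r homX] nradX] := hX.
have [Phi [Phi0 hPhi fPhi]] := extactic_flat (dhomog_basis_free hv)
  (fun j => dhomog_is_dhomog (tnth v j)) E0.
have [k [P [Q [lek hP hQ ncol [Q0 E]]]]] :=
  flat_first_integral charC homX nradX Phi0 hPhi fPhi.
have [l [P' [Q' [lel [hP' hQ'] [Q'0 cop] ncol' E']]]] :=
  coprime_representative charC hP hQ Q0 ncol E.
exists l, (FracField.tofrac P' / FracField.tofrac Q'); split.
  exact: leq_trans lel lek.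
exact: first_integral_quotient.
Qed.
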